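(* Consider a Markov decision process $(r,\Gamma,\beta,P)$ with state space $\mathsf X$ and action space $\mathsf A$ satisfying the standing assumptions described in the context, and let $\sigma\in\Sigma$. If $P_\sigma$ is open set irreducible and $\sigma$ is continuous (as a map $\mathsf X\to\mathsf A$), then the following three statements are equivalent: (E1) there exists $x\in\mathsf X$ such that $v_s(x)\le v_\sigma(x)$ for all $s\in\Sigma$; (E2) there exists a Borel probability measure $\rho$ on $\mathsf X$ such that $\int v_s\,\mathrm d\rho\le\int v_\sigma\,\mathrm d\rho$ for all $s\in\Sigma$; (E3) $\sigma$ is an optimal policy, i.e. $v_\sigma(x)=v^*(x)$ for all $x\in\mathsf X$.
   Context: $\mathsf X$ and $\mathsf A$ are metric spaces; $b\mathsf X$ is the space of bounded Borel measurable functions $\mathsf X\to\mathbb R$ (supremum norm, pointwise order), $cb\mathsf X$ the continuous ones. A Markov decision process is a tuple $(r,\Gamma,\beta,P)$ where: $\beta\in(0,1)$; $\Gamma$ is a nonempty, compact-valued, continuous correspondence from $\mathsf X$ to $\mathsf A$; with $\mathsf G=\{(x,a): a\in\Gamma(x)\}$, $r:\mathsf G\to\mathbb R$ is bounded and continuous; for each $(x,a)\in\mathsf G$, $P(x,a,\cdot)$ is a Borel probability measure on $\mathsf X$, and $(x,a)\mapsto\int v(x')P(x,a,\mathrm dx')$ is continuous on $\mathsf G$ for every $v\in cb\mathsf X$. $\Sigma$ is the set of Borel measurable $\sigma:\mathsf X\to\mathsf A$ with $\sigma(x)\in\Gamma(x)$ for all $x$. For $\sigma\in\Sigma$, $r_\sigma(x)=r(x,\sigma(x))$,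 $P_\sigma(x,\mathrm dx')=P(x,\sigma(x),\mathrm dx')$ with Markov operator $(P_\sigma f)(x)=\int f(x')P_\sigma(x,\mathrm dx')$, $P_\sigma^n$ the $n$-step kernel, and $v_\sigma=\sum_{t\ge0}(\beta P_\sigma)^t r_\sigma$. The value function is $v^*(x)=\sup_{s\in\Sigma}v_s(x)$; $\sigma$ is optimal if $v_\sigma=v^*$ on $\mathsf X$. For a transition kernel $Q$ on $\mathsf X$, $y$ is $Q$-reachable from $x$ if for every open neighborhood $G$ of $y$ there is $n\in\mathbb N=\{1,2,\dots\}$ with $Q^n(x,G)>0$; $Q$ is open set irreducible if every $y\in\mathsf X$ is $Q$-reachable from every $x\in\mathsf X$. *)

(* Defs.v *)
From HB Require Import structures.
From mathcomp Require Import all_boot all_order all_algebra.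
From mathcomp Require Import all_classical all_reals all_analysis.
Set Implicit Arguments.
Unset Strict Implicit.
Unset Printing Implicit Defensive.
Import Order.TTheory GRing.Theory Num.Theory.
Import numFieldNormedType.Exports.
Local Open Scope classical_set_scope.
Local Open Scope ring_scope.

#[short(type="pointedMetricType")]
HB.structure Definition PointedMetric (K : numDomainType) :=
  { M of Metric K M & Pointed M }.

Definition borel (T : ptopologicalType) := g_sigma_algebraType (@open T).

Section MDP.
Context {R : realType} (X A : pointedMetricType R).

Notation BX := (borel X).
Notation BA := (borel A).

Definition uhc (Gam : X -> set A) :=
  forall x (U : set A), open U -> Gam x `<=` U ->
    \forall y \near x, Gam y `<=` U.
Definition lhc (Gam : X -> set A) :=
  forall x (U : set A), open U -> Gam x `&` U !=set0 ->
    \forall y \near x, Gam y `&` U !=set0.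
Definition continuous_corr (Gam : X -> set A) := uhc Gam /\ lhc Gam.

Definition graph (Gam : X -> set A) : set (X * A) :=
  [set p | Gam p.1 p.2].

Definition MDP (r : X -> A -> R) (Gam : X -> set A) (beta : R)
  (P : X -> A -> probability BX R) : Prop :=
  [/\ 0 < beta < 1,
      (forall x, Gam x !=set0) /\ (forall x, compact (Gam x)),
      continuous_corr Gam,
      (exists M, forall x a, Gam x a -> `|r x a| <= M) /\
        {within graph Gam, continuous (fun p : X * A => r p.1 p.2)} &
      forall v : X -> R, continuous v -> (exists M, forall x, `|v x| <= M) ->
        {within graph Gam,
          continuous (fun p : X * A => \int[P p.1 p.2]_(y in [set: BX]) v y)}].

Definition policy (Gam : X -> set A) (s : X -> A) : Prop :=
  measurable_fun [set: BX] (s : BX -> BA) /\ forall x, Gam x (s x).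

Definition Pop (P : X -> A -> probability BX R) (s : X -> A) (f : X -> R)
  : X -> R := fun x => \int[P x (s x)]_(y in [set: BX]) f y.

Definition Pn (P : X -> A -> probability BX R) (s : X -> A) (n : nat)
  (x : X) (B : set X) : R := iter n (Pop P s) (\1_B) x.

Definition vpol (r : X -> A -> R) (beta : R) (P : X -> A -> probability BX R)
  (s : X -> A) : X -> R :=
  fun x => limn (fun n => \sum_(t < n)
                   beta ^+ t * iter t (Pop P s) (fun y => r y (s y)) x).

Definition vstar (r : X -> A -> R) (Gam : X -> set A) (beta : R)
  (P : X -> A -> probability BX R) : X -> R :=
  fun x => sup [set vpol r beta P s x | s in policy Gam].

Definition optimal (r : X -> A -> R) (Gam : X -> set A) (beta : R)
  (P : X -> A -> probability BX R) (s : X -> A) : Prop :=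
  forall x, vpol r beta P s x = vstar r Gam beta P x.

Definition reachable (P : X -> A -> probability BX R) (s : X -> A) (x y : X) :=
  forall G : set X, open G -> G y -> exists n : nat, (0 < n)%N /\ 0 < Pn P s n x G.

Definition open_set_irreducible (P : X -> A -> probability BX R) (s : X -> A) :=
  forall x y, reachable P s x y.

End MDP.

(* Main.v *)
Require Import Defs.
From HB Require Import structures.
From mathcomp Require Import all_boot all_order all_algebra.
From mathcomp Require Import all_classical all_reals all_analysis.
From mathcomp Require wochoice finmap.
Import (canonicals, coercions) finmap.
From mathcomp Require Import measurable_realfun ring lra.
Set Implicit Arguments.
Unset Strict Implicit.
Unset Printing Implicit Defensive.
Import Order.TTheory GRing.Theory Num.Theory.
Import numFieldNormedType.Exports.
Local Open Scope classical_set_scope.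
Local Open Scope ring_scope.

(** Let [u] be the value of the continuous policy [sigma]; it is a continuous
    function. If some pair [(y, a)] of the graph satisfies
    [r y a + beta * P u (y, a) > u y], lower hemicontinuity gives an open set [G]
    around [y] on which the one-step reward-to-go can be improved by a fixed
    amount. Use a measurable improving selection there and [sigma] elsewhere:
    the resulting policy [s] satisfies [vpol s - u >= beta * P_s (vpol s - u)],
    hence [vpol s >= u], and since [sigma] reaches [G] from every state,
    [vpol s > u] everywhere. This contradicts (E2). So [u] dominates its Bellman
    update, and therefore the value of every policy.

    The spaces are not assumed separable, so two measurability facts are not
    standard. First, [x |-> f (x, s x)] is Borel for [f] continuous on the graph
    and [s] a policy. Metric spaces have sigma-separated bases, and since
    [Gam] is compact-valued and upper hemicontinuous, locally only finitely many
    basic sets of [A] of a given level matter. The remaining difficulty is that a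
    union of Borel sets lying in disjoint open sets may fail to be Borel when the
    Borel classes are unbounded; measurability of [s] excludes this, by a
    diagonal argument over Borel codes. Second, measurable selections exist: the
    same localization gives countably many open subsets of [X * A] that separate
    the points of each [Gam x], and one refines [Gam x] successively along them. *)

(** * Sigma-separated refinements of open covers of metric spaces *)

Section metric.
Context {R : realType} (M : metricType R).

Lemma metric_open_ball (x : M) (e : R) : open (ball x e).
Proof.
rewrite openE => y; rewrite ballEmdist /= => xy.
rewrite /interior; apply/nbhs_ballP; exists (e - mdist x y).
  by rewrite /= subr_gt0.
move=> z; rewrite ballEmdist /= ltrBrDl.
exact: le_lt_trans (metric_triangle _ _ _).
Qed.

(** Stone's paracompactness argument: with the indices well-ordered, a centre [c] is given to the
    first [i] with [U i c], and [V n i] joins the balls of radius [rad n] around those centres of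
    [i] whose ball of radius [3 * rad n] lies in [U i]. Centres of different indices are then at
    least [3 * rad n] apart. *)
Lemma sigma_separated_refinement (U : M -> set M) :
  (forall x, open (U x)) -> (forall x, U x x) ->
  exists (V : nat -> M -> set M) (de : nat -> R),
    [/\ forall n i, open (V n i), forall n i, V n i `<=` U i,
        forall x, exists n i, V n i x, forall n, 0 < de n &
        forall n i j x y, V n i x -> V n j y -> mdist x y < de n -> i = j].
Proof.
move=> oU Ux; have [le wo] := wochoice.well_ordering_principle M.
pose first i c := U i c /\ forall j, U j c -> le i j.
have firstP c : exists i, first i c.
  have [|i [[iU imin] _]] := wo [pred i | `[< U i c >]].
    by exists c; apply/asboolP; exact: Ux.
  exists i; split; first by move/asboolP: iU.
  by move=> j Uj; apply: imin; apply/asboolP.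
(* The well-ordering gives each nonempty set a unique minimum; antisymmetry is uniqueness on a
   pair. *)
have le_anti i j : le i j -> le j i -> i = j.
  move=> ij ji.
  have le_refl k : le k k.
    have [|z [[/eqP -> zmin] _]] := wo (pred1 k); first by exists k; apply: eqxx.
    by apply: zmin; apply: eqxx.
  have [|z [_ zuniq]] := wo (pred2 i j); first by exists i; rewrite inE eqxx.
  rewrite -(zuniq i); first rewrite -(zuniq j) //.
    by split=> [|k]; rewrite !inE ?eqxx ?orbT // => /orP[] /eqP ->.
  by split=> [|k]; rewrite !inE ?eqxx ?orbT // => /orP[] /eqP ->.
have le_total i j : le i j \/ le j i.
  have [|z [[zin zmin] _]] := wo (pred2 i j); first by exists i; rewrite inE eqxx.
  have zi : le z i by apply: zmin; rewrite inE eqxx.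
  have zj : le z j by apply: zmin; rewrite inE eqxx orbT.
  by move: zin; rewrite inE => /orP[] /eqP ze; [left|right]; rewrite -{1}ze.
pose rad n : R := n.+1%:R^-1.
have rad0 n : 0 < rad n by rewrite /rad.
pose S n i := [set c | first i c /\ ball c (3 * rad n) `<=` U i].
exists (fun n i => \bigcup_(c in S n i) ball c (rad n)), rad; split=> //.
- by move=> n i; apply: bigcup_open => c _; exact: metric_open_ball.
- move=> n i x [c [_ cU]] cx; apply: cU; apply: le_ball cx.
  by have := rad0 n; lra.
- move=> x; have [i [Ui imin]] := firstP x.
  have /nbhs_ballP[e /= e0 eU] : nbhs x (U i) by exact: open_nbhs_nbhs.
  have [n] : exists n, 0 + n.+1%:R^-1 < e / 3 by apply: ltr_add_invr; lra.
  rewrite add0r -/(rad n) => ne.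
  exists n, i, x; last exact: ballxx.
  split=> //; apply: subset_trans eU; apply: le_ball; lra.
- move=> n i j x y [c [[Uic imin] cU]] cx [d [[Ujd jmin] dU]] dy xy.
  have cd : mdist c d < 3 * rad n.
    move: cx dy; rewrite !ballEmdist /= => cx dy.
    have := metric_triangle c x d; have := metric_triangle x y d.
    rewrite (metric_sym y d); lra.
  apply: le_anti.
    by apply: imin; apply: dU; rewrite ballEmdist /= metric_sym.
  by apply: jmin; apply: cU; rewrite ballEmdist.
Qed.

End metric.

(** * Borel codes *)

(** A code records only how a Borel set is built; the open sets sit in [psi]. One code can thus be
    evaluated on different open sets, and the codes form a fixed type against which to
    diagonalize. *)
Inductive code := CAtom of nat | CCompl of code | CUnion of (nat -> code).

Fixpoint eval T (psi : nat -> set T) (c : code) : set T :=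
  match c with
  | CAtom n => psi n
  | CCompl d => ~` eval psi d
  | CUnion f => \bigcup_n eval psi (f n)
  end.

Fixpoint rename (g : nat -> nat) (c : code) : code :=
  match c with
  | CAtom n => CAtom (g n)
  | CCompl d => CCompl (rename g d)
  | CUnion f => CUnion (fun n => rename g (f n))
  end.

Lemma eval_rename T (psi : nat -> set T) g c :
  eval psi (rename g c) = eval (psi \o g) c.
Proof.
elim: c => [n|d IH|f IH] //=; first by rewrite IH.
by apply: eq_bigcupr => n _.
Qed.

(** Evaluation is pointwise, so atoms can be glued over disjoint open sets while the code stays the
    same. *)
Lemma eval_local T (psi phi : nat -> set T) x c :
  (forall n, psi n x <-> phi n x) -> (eval psi c x <-> eval phi c x).
Proof.
move=> h; elim: c => [n|d IH|f IH] //=; first by split=> nd /IH.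
by split=> -[n _ /IH hn]; exists n.
Qed.

(* The tree underlying a code, as a function on finite paths: this realises
   the type of codes as a subset of [nat -> nat]. *)
Fixpoint label (c : code) (p : seq nat) : nat :=
  match c, p with
  | CAtom n, _ => n.+2
  | CCompl _, [::] => 0%N
  | CCompl d, _ :: q => label d q
  | CUnion _, [::] => 1%N
  | CUnion f, k :: q => label (f k) q
  end.

(** The value at the empty path reveals the constructor, atoms being shifted by two; longer paths
    reveal the subtrees. *)
Lemma label_inj : injective label.
Proof.
elim=> [n|d IH|f IH] [m|d'|f'] e; have := congr1 (@^~ [::]) e => //=.
- by move=> [->].
- by move=> _; congr CCompl; apply: IH; apply/funext => p; exact: (congr1 (@^~ (0%N :: p)) e).
- move=> _; congr CUnion; apply/funext => k; apply: IH; apply/funext => p.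
  exact: (congr1 (@^~ (k :: p)) e).
Qed.

Section borel_codes.
Context (T : ptopologicalType).

Lemma open_borel (U : set T) : open U -> measurable (U : set (borel T)).
Proof. by move=> oU; exact: sub_sigma_algebra. Qed.

Lemma closed_borel (U : set T) : closed U -> measurable (U : set (borel T)).
Proof.
by move=> cU; rewrite -(setCK U); apply: measurableC; apply: open_borel; rewrite openC.
Qed.

Lemma eval_borel (psi : nat -> set T) c :
  (forall n, open (psi n)) -> measurable (eval psi c : set (borel T)).
Proof.
move=> op; elim: c => [n|d IH|f IH] /=; first exact: open_borel.
  exact: measurableC.
exact: bigcupT_measurable.
Qed.

Lemma borel_code (B : set T) : measurable (B : set (borel T)) ->
  exists c psi, (forall n, open (psi n)) /\ B = eval psi c.
Proof.
move: B; apply: smallest_sub; last first.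
  by move=> U oU; exists (CAtom 0), (fun=> U).
split.
- exists (CAtom 0), (fun=> set0); split=> // n; exact: open0.
- move=> U [c [psi [op ->]]]; exists (CCompl c), psi; split=> //.
  by rewrite setTD.
- move=> F /choice[c /choice[psi h]].
  (* The atoms of countably many codes are merged into one sequence by pairing indices. *)
  exists (CUnion (fun k => rename (fun n => pickle (k, n)) (c k))).
  exists (fun m => if unpickle m is Some (k, n) then psi k n else set0); split.
    move=> m; case: unpickle => [[k n]|]; [exact: (h k).1|exact: open0].
  rewrite /=; apply: eq_bigcupr => k _; rewrite eval_rename {1}(h k).2.
  congr eval.
  by apply/funext => n /=; rewrite pickleK.
Qed.

(* If no single code worked for all the pieces, choosing for each code a piece
   where it fails would give a family whose union is Borel, hence has a code,
   and that code works for all the chosen pieces. *)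
Lemma disjoint_bigcup_borel (J : Type) (W B : J -> set T) :
  (forall j, open (W j)) -> (forall i j x, W i x -> W j x -> i = j) ->
  (forall f : code -> J,
     measurable (\bigcup_c (W (f c) `&` B (f c)) : set (borel T))) ->
  measurable (\bigcup_j (W j `&` B j) : set (borel T)).
Proof.
move=> oW dW mB.
pose codes D j := exists psi : nat -> set T,
  (forall n, open (psi n)) /\ W j `&` B j = W j `&` eval psi D.
have [D DP] : exists D, forall j, codes D j.
  apply: contrapT => /forallNP nD.
  have /choice[f nf] : forall D, exists j, ~ codes D j.
    by move=> D; apply/existsNP; exact: nD.
  have [D0 [psi [op e]]] := borel_code (mB f).
  apply: (nf D0); exists psi; split=> //; rewrite -e.
  apply/seteqP; split=> x [Wx]; first by move=> Bx; split=> //; exists D0.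
  by move=> [c _ [Wc Bc]]; split=> //; rewrite (dW _ _ _ Wx Wc).
have [psi psiP] := choice DP.
(* All pieces share the code [D], so their [n]-th atoms can be glued into a single open set, which
   on [W j] agrees with [psi j n] by disjointness. *)
suff -> : \bigcup_j (W j `&` B j) =
    (\bigcup_j W j) `&` eval (fun n => \bigcup_j (W j `&` psi j n)) D.
  apply: (@measurableI _ (borel T)).
    by apply: open_borel; apply: bigcup_open.
  apply: eval_borel => n; apply: bigcup_open => j _; apply: openI => //.
  exact: (psiP j).1.
have loc j x : W j x ->
    (eval (psi j) D x <-> eval (fun n => \bigcup_j (W j `&` psi j n)) D x).
  move=> Wx; apply: eval_local => n; split; first by exists j.
  by move=> [i _ [Wi]]; rewrite (dW _ _ _ Wi Wx).
apply/seteqP; split=> x.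
  move=> [j _ WB]; have Wj := WB.1; split; first by exists j.
  by apply/(loc j) => //; move: WB; rewrite (psiP j).2 => -[].
move=> [[j _ Wj] /(loc j)] /(_ Wj) ev.
by exists j => //; rewrite (psiP j).2.
Qed.

End borel_codes.

(** Each of the finitely many other sequences disagrees with [g e] at some place; a prefix reaching
    past all these places is enough. *)
Lemma prefix_isolate (I : eqType) (g : I -> nat -> nat) (e : I) (s : seq I) :
  (forall i, i \in s -> g i = g e -> i = e) ->
  exists N, forall i, i \in s -> mkseq (g i) N = mkseq (g e) N -> i = e.
Proof.
elim: s => [|j s IH] inj; first by exists 0%N.
have [|N NP] := IH; first by move=> i iS; apply: inj; rewrite inE iS orbT.
have [->|je] := eqVneq j e.
  by exists N => i; rewrite inE => /orP[/eqP ->//|]; exact: NP.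
have [m jm] : exists m, g j m <> g e m.
  apply: contrapT => /forallNP h; move/eqP: je; apply; apply: inj; first by rewrite inE eqxx.
  by apply/funext => m; apply: contrapT; exact: h.
have pre (a b : nat -> nat) (K L : nat) :
    (K <= L)%N -> mkseq a L = mkseq b L -> mkseq a K = mkseq b K.
  move=> KL ab; apply/eq_in_map => k; rewrite mem_iota add0n /= => kK.
  have kL : (k < L)%N by exact: leq_trans KL.
  by rewrite -(nth_mkseq 0%N a kL) ab nth_mkseq.
exists (maxn N m.+1) => i; rewrite inE => /orP[/eqP ->|iS] h; last first.
  by apply: NP => //; apply: pre h; exact: leq_maxl.
exfalso; apply: jm; have mm : (m < maxn N m.+1)%N by exact: leq_maxr.
by rewrite -(nth_mkseq 0%N (g j) mm) h nth_mkseq.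
Qed.

Section local_rectangles.
Context (T S : ptopologicalType) (I : choiceType) (J : Type).
Variables (s : T -> S) (W : J -> set T) (V : I -> set S).
Variables (F : J -> seq I) (e : J -> I).
Hypothesis ms : measurable_fun [set: borel T] (s : borel T -> borel S).
Hypothesis oW : forall j, open (W j).
Hypothesis dW : forall i j x, W i x -> W j x -> i = j.
Hypothesis oV : forall i, open (V i).
Hypothesis WVF : forall j x i, W j x -> V i (s x) -> i \in F j.

(* By [disjoint_bigcup_borel] it suffices to treat a family of rectangles
   indexed by codes. The second sides occurring there have indices that inject
   into [nat -> nat], so that countably many open sets of [S], given by
   finite prefixes, isolate [V (e j)] from the finitely many other [V i]
   relevant to [W j]. *)
Lemma local_rectangles_borel :
  measurable (\bigcup_j (W j `&` s @^-1` V (e j)) : set (borel T)).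
Proof.
apply: disjoint_bigcup_borel => // f.
(* An index occurring in some [F (f c)] is recovered from such a code [c] and a position in that
   list. *)
pose idx i (ck : code * nat) := (ck.2 < size (F (f ck.1)))%N /\
  nth i (F (f ck.1)) ck.2 = i.
have [h hP] : exists h : I -> code * nat,
    forall i, (exists c, i \in F (f c)) -> idx i (h i).
  suff /choice[h hP] : forall i, exists ck, (exists c, i \in F (f c)) -> idx i ck.
    by exists h.
  move=> i.
  have [[c ic]|nc] := pselect (exists c, i \in F (f c)); last by exists (CAtom 0, 0%N).
  by exists (c, index i (F (f c))) => _; split; rewrite ?index_mem ?nth_index.
(* The sequence [g i] starts with the position and continues with the labels of the code along all
   finite paths. *)
pose g i n := if n is m.+1 then label (h i).1 (odflt [::] (unpickle m)) else (h i).2.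
have g_inj i j : (exists c, i \in F (f c)) -> (exists c, j \in F (f c)) ->
    g i = g j -> i = j.
  move=> /hP[hi ei] /hP[hj ej] gij.
  have h2 : (h i).2 = (h j).2 by exact: (congr1 (@^~ 0%N) gij).
  have h1 : (h i).1 = (h j).1.
    apply: label_inj; apply/funext => p.
    have := congr1 (@^~ (pickle p).+1) gij; rewrite /g => gp.
    by move: gp; cbv beta iota; rewrite pickleK.
  by rewrite -ei -ej h1 h2; apply: set_nth_default; rewrite -h2 -h1.
(* [C q] holds of the codes [c] for which the prefix [q] leaves no candidate in [F (f c)] except
   [e (f c)]. *)
pose C (q : seq nat) c :=
  forall i, i \in F (f c) -> mkseq (g i) (size q) = q -> i = e (f c).
pose V' q := \bigcup_(i in [set i | mkseq (g i) (size q) = q]) V i.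
pose G n := if unpickle n is Some q then
  (\bigcup_(c in C q) W (f c)) `&` s @^-1` V' q else set0.
suff -> : \bigcup_c (W (f c) `&` s @^-1` V (e (f c))) = \bigcup_n G n.
  apply: (@bigcupT_measurable _ (borel T)) => n; rewrite /G; case: unpickle => [q|]; last exact: measurable0.
  apply: (@measurableI _ (borel T)).
    by apply: open_borel; apply: bigcup_open.
  rewrite -[_ @^-1` _]setTI; apply: ms => //; apply: open_borel.
  exact: bigcup_open.
apply/seteqP; split=> x.
  move=> [c _ [Wc Vc]]; have ec := WVF Wc Vc.
  have [|N NP] := @prefix_isolate _ g (e (f c)) (F (f c)).
    by move=> i ic; apply: g_inj; exists c.
  exists (pickle (mkseq (g (e (f c))) N)) => //; rewrite /G pickleK; split.
    by exists c => //; rewrite /C /= size_mkseq => i /NP.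
  by exists (e (f c)) => //=; rewrite size_mkseq.
move=> [n _]; rewrite /G; case: unpickle => [q|//] [[c Cc Wc] [i /= iq Vi]].
by exists c => //; split=> //; rewrite /= -(Cc i) //; exact: WVF Wc Vi.
Qed.

End local_rectangles.

(** * Measurability along policies and measurable selections *)

Lemma open_setX (T S : topologicalType) (U : set T) (V : set S) :
  open U -> open V -> open (U `*` V).
Proof.
move=> oU oV; suff -> : U `*` V = fst @^-1` U `&` snd @^-1` V by
  apply: openI; apply: open_comp => // p _; [exact: cvg_fst|exact: cvg_snd].
by apply/seteqP; split.
Qed.

Section correspondence.
Context {R : realType} (X A : pointedMetricType R) (Gam : X -> set A).
Hypothesis ucG : uhc Gam.
Hypothesis cptG : forall x, compact (Gam x).

(** A tube argument: if [L] misses the compact [Gam x0] above [x0], finitely many product balls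
    avoiding [L] cover it, and upper hemicontinuity keeps nearby [Gam x] inside that cover. *)
Lemma corr_meets_closed (L : set (X * A)) : closed L ->
  closed [set x | exists a, Gam x a /\ L (x, a)].
Proof.
move=> cL; rewrite -openC openE => x0 /= nL.
have /choice[e eP] : forall a, exists e : R, Gam x0 a -> 0 < e /\
    forall x b, ball x0 e x -> ball a e b -> ~ L (x, b).
  move=> a; have [Ga|nG] := pselect (Gam x0 a); last by exists 0.
  have : nbhs (x0, a) (~` L).
    apply: open_nbhs_nbhs; split; first by rewrite openC.
    by move=> La; apply: nL; exists a.
  move=> /nbhs_ballP[e /= e0 eL]; exists e => _; split=> // x b xe be.
  exact: (eL (x, b)).
have := @cptG x0; rewrite compact_cover => /(_ _ (Gam x0) (fun a => ball a (e a))).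
case.
- by move=> a _; exact: metric_open_ball.
- by move=> a Ga; exists a => //; apply: ballxx; exact: (eP a Ga).1.
move=> D DG DP.
have oU : open (cover [set` D] (fun a => ball a (e a))).
  by apply: bigcup_open => a _; exact: metric_open_ball.
have N1 := ucG oU DP.
have N2 : \forall x \near x0, forall a, a \in D -> ball x0 (e a) x.
  have : nbhs x0 (\bigcap_(a in [set` D]) ball x0 (e a)).
    apply: filter_bigI => a aD; apply: nbhsx_ballx.
    by have /set_mem Ga := DG _ aD; exact: (eP a Ga).1.
  by apply: filterS => x h a aD; exact: h.
apply: filterS2 N1 N2 => x xU xD [b [/xU[a /= aD ab] Lb]].
have /set_mem Ga := DG _ aD.
exact: ((eP a Ga).2 x b (xD a aD) ab Lb).
Qed.

(** [V] is a base of [A] made of sigma-separated refinements of the covers by balls of radius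
    [rad p]. By compactness and upper hemicontinuity every point of [X] has a neighbourhood on which
    only finitely many [V p l i] meet [Gam]; [W] refines these neighbourhoods into countably many
    disjoint layers, and [F] lists the relevant indices. *)
Lemma corr_localization :
  exists (V : nat -> nat -> A -> set A) (W : nat -> nat -> nat -> X -> set X)
    (F : nat -> nat -> X -> seq A),
  [/\ forall p l i, open (V p l i),
      forall a (e : R), 0 < e -> exists p l i, V p l i a /\ V p l i `<=` ball a e,
      forall p l n j, open (W p l n j),
      forall p l x, exists n j, W p l n j x &
      (forall p l n i j x, W p l n i x -> W p l n j x -> i = j) /\
      (forall p l n j x a i, W p l n j x -> Gam x a -> V p l i a -> i \in F p l j)].
Proof.
pose rad p : R := p.+1%:R^-1.
have rad0 p : 0 < rad p by rewrite /rad.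
have /choice[V /choice[de VP]] : forall p, exists (V : nat -> A -> set A) (de : nat -> R),
    [/\ forall n i, open (V n i), forall n i, V n i `<=` ball i (rad p),
        forall x, exists n i, V n i x, forall n, 0 < de n &
        forall n i j x y, V n i x -> V n j y -> mdist x y < de n -> i = j].
  move=> p; apply: sigma_separated_refinement => x; first exact: metric_open_ball.
  exact: ballxx.
have loc p l x0 : exists NF : set X * seq A, [/\ open NF.1, NF.1 x0 &
    forall x a i, NF.1 x -> Gam x a -> V p l i a -> i \in NF.2].
  have [_ _ _ /(_ l) de0 /(_ l) sep] := VP p.
  (* A ball of half the separation radius meets at most one [V p l i]; [ch] gives its index, by
     default [a] if it meets none. *)
  have /choice[ch chP] : forall a, exists j, forall i b,
      V p l i b -> ball a (de p l / 2) b -> i = j.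
    move=> a; have [[j [c [Vc ac]]]|nj] :=
      pselect (exists j c, V p l j c /\ ball a (de p l / 2) c); last first.
      by exists a => i b Vb ab; exfalso; apply: nj; exists i, b.
    exists j => i b Vb ab; apply: sep Vb Vc _.
    move: ab ac; rewrite !ballEmdist /= => ab ac.
    by have := metric_triangle b a c; rewrite (metric_sym b a); lra.
  have := @cptG x0; rewrite compact_cover => /(_ _ setT (fun a => ball a (de p l / 2))).
  case.
  - by move=> a _; exact: metric_open_ball.
  - by move=> a Ga; exists a => //; apply: ballxx; lra.
  move=> D _ DP.
  have oU : open (cover [set` D] (fun a => ball a (de p l / 2))).
    by apply: bigcup_open => a _; exact: metric_open_ball.
  have N1 := ucG oU DP.
  exists (interior [set x | Gam x `<=` cover [set` D] (fun a => ball a (de p l / 2))],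
    map ch (finmap.enum_fset D)); split => /=; [exact: open_interior|exact: N1|].
  move=> x a i /interior_subset/= xD /xD[b /= bD ba] Va.
  by rewrite (chP b i a) //; apply: map_f.
have [NF NFP] : exists NF : nat -> nat -> X -> set X * seq A, forall p l x0,
    [/\ open (NF p l x0).1, (NF p l x0).1 x0 &
    forall x a i, (NF p l x0).1 x -> Gam x a -> V p l i a -> i \in (NF p l x0).2].
  have /choice[NF h] : forall p, exists NF : nat -> X -> set X * seq A, forall l x0,
    [/\ open (NF l x0).1, (NF l x0).1 x0 &
    forall x a i, (NF l x0).1 x -> Gam x a -> V p l i a -> i \in (NF l x0).2].
    move=> p; have /choice[NF h] : forall l, exists NF : X -> set X * seq A, forall x0,
      [/\ open (NF x0).1, (NF x0).1 x0 &
      forall x a i, (NF x0).1 x -> Gam x a -> V p l i a -> i \in (NF x0).2].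
      by move=> l; have /choice[NF h] := loc p l; exists NF.
    by exists NF.
  by exists NF.
have [W WP] : exists W : nat -> nat -> nat -> X -> set X, forall p l,
    [/\ forall n i, open (W p l n i), forall n i, W p l n i `<=` (NF p l i).1,
        forall x, exists n i, W p l n i x &
        forall n i j x, W p l n i x -> W p l n j x -> i = j].
  have ref p l : exists W : nat -> X -> set X,
    [/\ forall n i, open (W n i), forall n i, W n i `<=` (NF p l i).1,
        forall x, exists n i, W n i x &
        forall n i j x, W n i x -> W n j x -> i = j].
    have [x|x|W [d [W1 W2 W3 d0 W4]]] := @sigma_separated_refinement R X (fun x => (NF p l x).1).
    - by have [] := NFP p l x.
    - by have [] := NFP p l x.
    exists W; split=> // n i j x Wi Wj; apply: W4 Wi Wj _.
    by rewrite mdistxx.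
  have /choice[W h] : forall p, exists W : nat -> nat -> X -> set X, forall l,
    [/\ forall n i, open (W l n i), forall n i, W l n i `<=` (NF p l i).1,
        forall x, exists n i, W l n i x &
        forall n i j x, W l n i x -> W l n j x -> i = j].
    by move=> p; have /choice[W h] := ref p; exists W.
  by exists W.
exists V, W, (fun p l j => (NF p l j).2); split.
- by move=> p; have [] := VP p.
- move=> a e e0; have [p] : exists p, 0 + p.+1%:R^-1 < e / 2 by apply: ltr_add_invr; lra.
  rewrite add0r -/(rad p) => pe; have [_ /(_ _ _ _) Vb /(_ a)[l [i Va]] _ _] := VP p.
  exists p, l, i; split=> // b /Vb; move/Vb: Va; rewrite !ballEmdist /= => ia ib.
  by have := metric_triangle a i b; rewrite (metric_sym a i); lra.
- by move=> p l; have [] := WP p l.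
- by move=> p l; have [] := WP p l.
split; first by move=> p l; have [] := WP p l.
move=> p l n j x a i Wx Ga Va; have [_ _ /(_ x a i)] := NFP p l j; apply=> //.
by have [_ h _ _] := WP p l; exact: h Wx.
Qed.

(** The set is a countable union, over levels, layers and positions in the finite lists, of unions
    over [j] of rectangles treated by [local_rectangles_borel]. *)
Lemma policy_open_borel (s : X -> A) (O : set (X * A)) : policy Gam s -> open O ->
  measurable ([set x | O (x, s x)] : set (borel X)).
Proof.
move=> [ms sG] oO; have [V [W [F [oV Vb oW Wc [dW WVF]]]]] := corr_localization.
pose U p l i := interior [set x | forall a, V p l i a -> O (x, a)].
(* Past the end of the list this is [point], which is harmless: by the choice of [U] every rectangle
   used lies in the target set. *)
pose e p l k j := nth point (F p l j) k.
suff -> : [set x | O (x, s x)] = \bigcup_p \bigcup_l \bigcup_n \bigcup_k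
    \bigcup_j ((W p l n j `&` U p l (e p l k j)) `&` s @^-1` V p l (e p l k j)).
  do 4! apply: (@bigcupT_measurable _ (borel X)) => ?.
  apply: (@local_rectangles_borel _ _ _ _ s) => //.
  - by move=> j; apply: openI => //; exact: open_interior.
  - by move=> i j x [Wi _] [Wj _]; exact: dW Wi Wj.
  - by move=> j x i [Wj _] Vi; exact: WVF Wj (sG x) Vi.
apply/seteqP; split=> x /=; last first.
  by move=> [p _ [l _ [n _ [k _ [j _ [[_ /interior_subset Ux] Vx]]]]]]; exact: Ux.
move=> Ox; have : nbhs (x, s x) O by exact: open_nbhs_nbhs.
move=> /nbhs_ballP[d /= d0 dO]; have [p [l [i [Vi Vd]]]] := Vb (s x) d d0.
have [n [j Wj]] := Wc p l x; have iF := WVF _ _ _ _ _ _ _ Wj (sG x) Vi.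
exists p => //; exists l => //; exists n => //; exists (index i (F p l j)) => //.
exists j => //; rewrite /e nth_index //; split=> //; split=> //.
apply/nbhs_ballP; exists d => //= y xy a Va.
by apply: (dO (y, a)); split=> //; exact: Vd.
Qed.

Lemma closed_section (L : set (X * A)) x : closed L -> closed [set a | L (x, a)].
Proof.
move=> cL; apply: (@closed_comp _ _ (fun a => (x, a)) L) => // a _.
by apply: cvg_pair => /=; [exact: cvg_cst|exact: cvg_id].
Qed.

Hypothesis neG : forall x, Gam x !=set0.

(* Keep in [Gam x] only the points of [L n] whenever there are any, for
   [n = 0, 1, ...]; if the complements of the [L n] separate points, a single
   point remains. *)
Fixpoint refine (L : nat -> set (X * A)) n x : set A :=
  if n is m.+1 then
    [set a | refine L m x a /\
      ((exists b, refine L m x b /\ L m (x, b)) -> L m (x, a))]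
  else Gam x.

(** Refining along [L0] first forces the selected point into [L0] wherever this is possible. *)
Lemma corr_selection (L0 : set (X * A)) : closed L0 ->
  exists s, policy Gam s /\
    forall x a, Gam x a -> L0 (x, a) -> L0 (x, s x).
Proof.
move=> cL0; have [V [W [F [oV Vb oW Wc [dW WVF]]]]] := corr_localization.
(* Taking the [k]-th index of each list and uniting over the disjoint [W p l n j] leaves only
   countably many open sets, which still separate the points of each [Gam x]. *)
pose O q := if unpickle q is Some (p, l, n, k) then
    \bigcup_j (W p l n j `*` V p l (nth point (F p l j) k)) else (set0 : set (X * A)).
pose L n := if n is q.+1 then ~` O q else L0.
have cL n : closed (L n).
  case: n => [//|q]; rewrite /L closedC /O; case: unpickle => [[[[p l] n] k]|]; last exact: open0.
  by apply: bigcup_open => j _; exact: open_setX.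
pose K := refine L.
have KS n x : K n.+1 x `<=` K n x by move=> a [].
have Kle m n x : (m <= n)%N -> K n x `<=` K m x.
  elim: n => [|n IH]; first by rewrite leqn0 => /eqP ->.
  by rewrite leq_eqVlt => /predU1P[->//|/IH h]; apply: subset_trans h; exact: KS.
have K0 n x : K n x !=set0.
  elim: n => [|n [a Ka]]; first exact: (@neG x).
  have [[b [Kb Lb]]|nb] := pselect (exists b, K n x b /\ L n (x, b)); first by exists b.
  by exists a; split=> // h; case: (nb h).
have cK n x : closed (K n x).
  elim: n => [|n IH]; first by apply: compact_closed => //; exact: metric_hausdorff.
  have [h|nb] := pselect (exists b, K n x b /\ L n (x, b)).
    suff -> : K n.+1 x = K n x `&` [set a | L n (x, a)].
      by apply: closedI => //; exact: closed_section.
    by apply/seteqP; split=> a [Ka La]; split=> //; exact: La.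
  suff -> : K n.+1 x = K n x by [].
  by apply/seteqP; split=> a; [case|split=> // /nb].
(* Generalizing over [L'] makes the induction work: a refinement step only splits on whether [K n x]
   meets [L n], and both cases are of the same form one stage earlier. *)
have mK n L' : closed L' ->
    measurable ([set x | exists a, K n x a /\ L' (x, a)] : set (borel X)).
  elim: n L' => [|n IH] L' cL'.
    by apply: closed_borel; exact: corr_meets_closed.
  pose B L' := [set x | exists a, K n x a /\ L' (x, a)].
  suff -> : [set x | exists a, K n.+1 x a /\ L' (x, a)] =
      B (L n `&` L') `|` (~` B (L n) `&` B L').
    apply: (@measurableU _ (borel X)); first by apply: IH; exact: closedI.
    apply: (@measurableI _ (borel X)); last exact: IH.
    by apply: (@measurableC _ (borel X)); exact: IH.
  apply/seteqP; split=> x /=.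
    move=> [a [[Ka h] L'a]]; have [hb|nb] := pselect (B (L n) x).
      by left; exists a; split=> //; split=> //; exact: h.
    by right; split=> //; exists a.
  move=> [[a [Ka [La L'a]]]|[nb [a [Ka L'a]]]]; first by exists a.
  by exists a; split=> //; split.
(* A cluster point of a sequence chosen in [K n x] and [C] lies in all these nested closed sets. *)
have Kcap x (C : set A) : closed C -> (forall n, K n x `&` C !=set0) ->
    exists a, C a /\ forall n, K n x a.
  move=> cC /choice[u uP].
  have [|a [_ ca]] := @cptG x (u @ \oo) _.
    by exists 0%N => // n _; apply: (Kle 0%N n) => //; exact: (uP n).1.
  exists a; split.
    apply: cC => B Ba; apply: (ca C B) => //.
    by exists 0%N => // n _; exact: (uP n).2.
  move=> n; apply: (cK n x) => B Ba; apply: (ca (K n x) B) => //.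
  by exists n => // m /= nm; apply: (Kle n m) => //; exact: (uP m).1.
have /choice[s sP] : forall x, exists a, forall n, K n x a.
  move=> x; have [n|a [_ h]] := Kcap x setT closedT; last by exists a.
  by rewrite setIT; exact: K0.
(* A basic set around [a] that excludes [s x] yields some [O q] containing [(x, a)] but not
   [(x, s x)], so [a] is discarded at stage [q.+2], where [L q.+1] is used. *)
have s_uniq x a : (forall n, K n x a) -> a = s x.
  move=> Ka; apply: contrapT => /eqP as_.
  have [p [l [i [Va Vd]]]] := Vb a (mdist a (s x)) ltac:(by rewrite mdist_gt0).
  have [n [j Wj]] := Wc p l x; have iF := WVF _ _ _ _ _ _ _ Wj (Ka 0%N) Va.
  pose q := pickle (p, l, n, index i (F p l j)).
  have [_ ] := Ka q.+2; apply; last first.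
    by rewrite /L /O /q pickleK; exists j => //; split=> //=; rewrite nth_index.
  exists (s x); split; first exact: (sP x q.+1).
  rewrite /L /O /q pickleK => -[j' _ [/= Wj']].
  rewrite (dW _ _ _ _ _ _ Wj' Wj) nth_index // => /Vd.
  by rewrite ballEmdist /= ltxx.
have msC (C : set A) : closed C -> measurable (s @^-1` C : set (borel X)).
  move=> cC; suff -> : s @^-1` C =
      \bigcap_n [set x | exists a, K n x a /\ (setT `*` C) (x, a)].
    apply: (@bigcapT_measurable _ (borel X)) => n; apply: mK.
    by rewrite setTX; apply: closed_comp => // p _; exact: cvg_snd.
  apply/seteqP; split=> x /=; first by move=> Cs n _; exists (s x).
  move=> h; have [n|a [Ca /s_uniq <-//]] := Kcap x C cC.
  by have [a [Ka [_ Ca]]] := h n I; exists a.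
exists s; split.
  split; last by move=> x; exact: (sP x 0%N).
  apply: (@measurability _ _ (borel X) (borel A) _ s (@open A)) => //.
  move=> _ [U oU <-]; rewrite setTI -(setCK U) preimage_setC.
  have cU : closed (~` U) by rewrite closedC.
  exact: (@measurableC _ (borel X) _ (msC _ cU)).
by move=> x a Ga La; have [_] := sP x 1%N; apply; exists a.
Qed.

End correspondence.

(** * Integration of bounded measurable functions *)

Section bounded_measurable.
Context {R : realType} (d : measure_display) (T : measurableType d).

Definition bmeas (f : T -> R) :=
  measurable_fun [set: T] f /\ exists M, forall x, `|f x| <= M.

Lemma bmeas_cst (c : R) : bmeas (fun=> c).
Proof. by split; [exact: measurable_cst|exists `|c|]. Qed.

Lemma bmeasD (f g : T -> R) : bmeas f -> bmeas g -> bmeas (fun x => f x + g x).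
Proof.
move=> [mf [M fM]] [mg [N gN]]; split; first exact: measurable_funD.
by exists (M + N) => x; rewrite (le_trans (ler_normD _ _)) // lerD.
Qed.

Lemma bmeasZ (c : R) (f : T -> R) : bmeas f -> bmeas (fun x => c * f x).
Proof.
move=> [mf [M fM]]; split; first exact: measurable_funM.
by exists (`|c| * M) => x; rewrite normrM ler_wpM2l.
Qed.

Lemma bmeasB (f g : T -> R) : bmeas f -> bmeas g -> bmeas (fun x => f x - g x).
Proof.
move=> bf bg; have := bmeasD bf (bmeasZ (-1) bg).
by under eq_fun do rewrite mulN1r.
Qed.

Lemma bmeas_indic (B : set T) : measurable B -> bmeas (\1_B : T -> R).
Proof.
move=> mB; split; first exact: measurable_indic.
by exists 1 => x; rewrite indicE; case: (_ \in _); rewrite ?normr1 ?normr0.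
Qed.

Variable mu : probability T R.

Lemma bmeas_integrable (f : T -> R) : bmeas f -> mu.-integrable [set: T] (EFin \o f).
Proof.
move=> [mf [M fM]]; apply: measurable_bounded_integrable => //.
  exact: fin_num_fun_lty.
exists M; split; first exact: num_real.
by move=> N MN x _ /=; apply: le_trans (fM x) _; exact: ltW.
Qed.

Lemma prob_Rintegral_cst (c : R) : \int[mu]_(x in [set: T]) c = c.
Proof. by rewrite Rintegral_cst //= probability_setT mulr1. Qed.

Lemma bmeas_Rintegral_le (f g : T -> R) : bmeas f -> bmeas g ->
  (forall x, f x <= g x) ->
  \int[mu]_(x in [set: T]) f x <= \int[mu]_(x in [set: T]) g x.
Proof.
by move=> bf bg fg; apply: le_Rintegral => //; exact: bmeas_integrable.
Qed.

Lemma bmeas_normr_Rintegral (f : T -> R) (M : R) : bmeas f ->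
  (forall x, `|f x| <= M) -> `|\int[mu]_(x in [set: T]) f x| <= M.
Proof.
move=> bf fM; rewrite ler_norml; apply/andP; split.
  rewrite -(prob_Rintegral_cst (- M)).
  apply: bmeas_Rintegral_le => // [|x]; first exact: bmeas_cst.
  by have := fM x; rewrite ler_norml => /andP[].
rewrite -(prob_Rintegral_cst M).
apply: bmeas_Rintegral_le => // [|x]; first exact: bmeas_cst.
by have := fM x; rewrite ler_norml => /andP[].
Qed.

Lemma bmeas_RintegralD (f g : T -> R) : bmeas f -> bmeas g ->
  \int[mu]_(x in [set: T]) (f x + g x) =
  \int[mu]_(x in [set: T]) f x + \int[mu]_(x in [set: T]) g x.
Proof. by move=> bf bg; rewrite RintegralD //; exact: bmeas_integrable. Qed.

Lemma bmeas_RintegralB (f g : T -> R) : bmeas f -> bmeas g ->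
  \int[mu]_(x in [set: T]) (f x - g x) =
  \int[mu]_(x in [set: T]) f x - \int[mu]_(x in [set: T]) g x.
Proof. by move=> bf bg; rewrite RintegralB //; exact: bmeas_integrable. Qed.

Lemma bmeas_RintegralZ (c : R) (f : T -> R) : bmeas f ->
  \int[mu]_(x in [set: T]) (c * f x) = c * \int[mu]_(x in [set: T]) f x.
Proof. by move=> bf; rewrite RintegralZl //; exact: bmeas_integrable. Qed.

(** Such an [f] vanishes almost everywhere, hence so does [g]. The contrapositive carries pointwise
    positivity over to integrals. *)
Lemma bmeas_Rintegral_support (f g : T -> R) : bmeas f -> bmeas g ->
  (forall x, 0 <= f x) -> (forall x, 0 <= g x) ->
  (forall x, 0 < g x -> 0 < f x) ->
  \int[mu]_(x in [set: T]) f x <= 0 -> \int[mu]_(x in [set: T]) g x = 0.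
Proof.
move=> bf bg f0 g0 gf If.
have abs (h : T -> R) : (forall x, 0 <= h x) ->
    (\int[mu]_(x in [set: T]) `|(EFin \o h) x| = \int[mu]_(x in [set: T]) (h x)%:E)%E.
  by move=> h0; apply: eq_integral => x _; rewrite /= ger0_norm.
have fin0 : (\int[mu]_(x in [set: T]) `|(EFin \o f) x|)%E = 0%E.
  rewrite abs // -(fineK (integrable_fin_num _ (bmeas_integrable bf))) //.
  congr EFin; apply/le_anti; rewrite [X in X && _]If /=.
  by apply: Rintegral_ge0 => x _.
have mfE h : bmeas h -> measurable_fun [set: T] (EFin \o h).
  by move=> [mh _]; exact/measurable_EFinP.
have /ae_eq_integral_abs : (\int[mu]_(x in [set: T]) `|(EFin \o f) x|)%E = 0%E by [].
move=> /(_ measurableT (mfE _ bf)) aef.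
have aeg : ae_eq mu [set: T] (EFin \o g) (cst 0%E).
  apply: filterS aef => x /(_ I) /= [fx] _; congr EFin.
  apply/eqP; rewrite eq_le g0 andbT leNgt; apply/negP => /gf.
  by rewrite fx ltxx.
have /ae_eq_integral_abs : ae_eq mu [set: T] (EFin \o g) (cst 0%E) by [].
move=> /(_ measurableT (mfE _ bg)); rewrite abs // => ig.
by rewrite /Rintegral ig.
Qed.

End bounded_measurable.
Arguments bmeas_cst {R d T} c.

(** * Continuous approximation of indicators of open sets *)

Section inner_radius.
Context {R : realType} (X : pointedMetricType R) (G : set X).

(** The distance to the complement of [G], capped at 1 so that it is also defined when [G] is the
    whole space; [t = 0] always qualifies because its ball is empty. *)
Definition inner_radius (x : X) : R :=
  sup [set t | 0 <= t <= 1 /\ ball x t `<=` G].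

Let radii x := [set t : R | 0 <= t <= 1 /\ ball x t `<=` G].

Let has_sup_radii x : has_sup (radii x).
Proof.
split; last by exists 1 => t [/andP[]].
exists 0; split; first by rewrite lexx ler01.
by move=> y; rewrite ballEmdist /= ltNge mdist_ge0.
Qed.

Lemma inner_radius_ge0 x : 0 <= inner_radius x.
Proof.
apply: ub_le_sup; first exact: (has_sup_radii x).2.
split; first by rewrite lexx ler01.
by move=> y; rewrite ballEmdist /= ltNge mdist_ge0.
Qed.

Lemma inner_radius_lip x y : inner_radius x <= inner_radius y + mdist x y.
Proof.
apply: ge_sup; first exact: (has_sup_radii x).1.
move=> t [/andP[t0 t1] tG]; rewrite -lerBlDr.
have [td|dt] := leP (t - mdist x y) 0; first exact: le_trans (inner_radius_ge0 y).
apply: ub_le_sup; first exact: (has_sup_radii y).2.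
split; first by rewrite ltW //=; have := mdist_ge0 x y; lra.
move=> z; rewrite ballEmdist /= => yz; apply: tG; rewrite ballEmdist /=.
by have := metric_triangle x y z; lra.
Qed.

Lemma inner_radius_continuous : continuous inner_radius.
Proof.
move=> x; apply/cvgrPdist_lt => e e0; near=> y.
have xy : mdist x y < e.
  have : ball x e y by near: y; exact: nbhsx_ballx.
  by rewrite ballEmdist.
have := inner_radius_lip x y; have := inner_radius_lip y x.
by rewrite (metric_sym y x) => h1 h2; rewrite ltr_norml; lra.
Unshelve. all: by end_near.
Qed.

Lemma inner_radius_out x : ~ G x -> inner_radius x = 0.
Proof.
move=> nG; apply/eqP; rewrite eq_le inner_radius_ge0 andbT.
apply: ge_sup; first exact: (has_sup_radii x).1.
move=> t [/andP[t0 t1] tG]; rewrite leNgt; apply/negP => t_gt0.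
by apply: nG; apply: tG; exact: ballxx.
Qed.

Lemma inner_radius_gt0 x : open G -> G x -> 0 < inner_radius x.
Proof.
move=> oG Gx; have /nbhs_ballP[e /= e0 eG] : nbhs x G by exact: open_nbhs_nbhs.
have m0 : 0 < Num.min e 1 by rewrite lt_min e0 ltr01.
apply: lt_le_trans m0 _; apply: ub_le_sup; first exact: (has_sup_radii x).2.
split; first by rewrite le_min ltW //= ler01 ge_min lexx orbT.
by apply: subset_trans eG; apply: le_ball; rewrite ge_min lexx.
Qed.

Lemma open_indic_approx : open G -> exists v : nat -> X -> R,
  [/\ forall n, continuous (v n), forall n x, 0 <= v n x <= 1 &
      forall x, v n x @[n --> \oo] --> (\1_G x : R)].
Proof.
move=> oG; exists (fun n x => Num.min 1 (n%:R * inner_radius x)); split.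
- move=> n x; apply: (@continuous_min _ _ (fun=> 1) (fun x => n%:R * inner_radius x)).
    exact: cvg_cst.
  by apply: cvgM; [exact: cvg_cst|exact: inner_radius_continuous].
- move=> n x; rewrite le_min ler01 ge_min lexx /= andbT.
  by rewrite mulr_ge0 // inner_radius_ge0.
move=> x; rewrite indicE; have [/set_mem Gx|/negP nG] := boolP (x \in G); last first.
  rewrite inner_radius_out; last by move=> Gx; apply: nG; exact: mem_set.
  under eq_fun do rewrite mulr0; rewrite minEle ler10 /=.
  exact: cvg_cst.
have r0 := inner_radius_gt0 oG Gx.
apply: cvg_near_cst; near=> n.
have nr : (inner_radius x)^-1 <= n%:R by near: n; exact: nbhs_infty_ger.
by rewrite minEle -ler_pdivrMr // div1r nr.
Unshelve. all: by end_near.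
Qed.

End inner_radius.

(** * Discounted values *)

Section discounted_series.
Context {R : realType} (beta : R) (f : nat -> R) (M : R).
Hypothesis b01 : 0 < beta < 1.
Hypothesis fM : forall t, `|f t| <= M.

Let S n := \sum_(t < n) beta ^+ t * f t.

Lemma discounted_cvg : cvgn S.
Proof.
have [b0 b1] := andP b01.
have -> : S = series (fun t => beta ^+ t * f t).
  by apply/funext => n; rewrite /S /series /= big_mkord.
apply: normed_cvg; apply: (@series_le_cvg _ _ (geometric M beta)).
- by move=> n /=.
- move=> n; rewrite /geometric /=; apply: mulr_ge0; first exact: le_trans (fM 0%N).
  by rewrite exprn_ge0 // ltW.
- move=> n; rewrite /geometric /= normrM normrX gtr0_norm // mulrC.
  by rewrite ler_wpM2r // exprn_ge0 // ltW.
by apply: is_cvg_geometric_series; rewrite gtr0_norm.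
Qed.

Lemma discounted_tail n : `|limn S - S n| <= M / (1 - beta) * beta ^+ n.
Proof.
have [b0 b1] := andP b01.
(* The bound is the exact finite geometric sum, which lets the induction close. *)
have step k : `|S (n + k)%N - S n| <= M / (1 - beta) * (beta ^+ n - beta ^+ (n + k)).
  elim: k => [|k IH]; first by rewrite addn0 !subrr normr0 mulr0.
  have -> : S (n + k.+1)%N - S n = S (n + k)%N - S n + beta ^+ (n + k) * f (n + k)%N.
    by rewrite addnS /S big_ord_recr /=; ring.
  apply: le_trans (ler_normD _ _) _.
  have -> : M / (1 - beta) * (beta ^+ n - beta ^+ (n + k.+1)) =
      M / (1 - beta) * (beta ^+ n - beta ^+ (n + k)) + beta ^+ (n + k) * M.
    by rewrite addnS exprS; field; rewrite subr_eq0 eq_sym lt_eqF.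
  rewrite lerD // normrM normrX gtr0_norm // ler_wpM2l // exprn_ge0 //.
  exact: ltW.
have M0 : 0 <= M by exact: le_trans (fM 0%N).
have step' k : `|S (n + k)%N - S n| <= M / (1 - beta) * beta ^+ n.
  apply: le_trans (step k) _; apply: ler_wpM2l.
    by rewrite divr_ge0 // subr_ge0 ltW.
  by rewrite gerBl exprn_ge0 // ltW.
have c : `|S m - S n| @[m --> \oo] --> `|limn S - S n|.
  apply: cvg_norm; apply: cvgB; [exact: discounted_cvg|exact: cvg_cst].
rewrite -(cvg_lim _ c) //; apply: limr_le; first by apply/cvg_ex; eexists; exact: c.
exists n => // m /= nm; rewrite -(subnKC nm); exact: step'.
Qed.

Lemma le_geometric_eq0 (a C : R) : (forall n, `|a| <= C * beta ^+ n) -> a = 0.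
Proof.
have [b0 b1] := andP b01 => h; apply/eqP; rewrite -normr_le0.
have c : (C * beta ^+ n) @[n --> \oo] --> 0 by apply: cvg_geometric; rewrite gtr0_norm.
rewrite -(cvg_lim _ c) //; apply: limr_ge; first by apply/cvg_ex; eexists; exact: c.
by exists 0%N => // m _; exact: h.
Qed.

End discounted_series.

(** * Markov operators and values of policies *)

Section mdp.
Context {R : realType} (X A : pointedMetricType R).
Variables (r : X -> A -> R) (Gam : X -> set A) (beta : R).
Variable P : X -> A -> probability (borel X) R.
Hypothesis H : MDP r Gam beta P.

Local Notation vp := (vpol r beta P).
Local Notation bmeas := (@bmeas R _ (borel X)).

Lemma mdp_beta : 0 < beta < 1. Proof. by case: H. Qed.
Lemma mdp_uhc : uhc Gam. Proof. by case: H => _ _ []. Qed.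
Lemma mdp_lhc : lhc Gam. Proof. by case: H => _ _ []. Qed.
Lemma mdp_compact x : compact (Gam x). Proof. by case: H => _ []. Qed.
Lemma mdp_nonempty x : Gam x !=set0. Proof. by case: H => _ []. Qed.
Lemma mdp_reward_continuous :
  {within graph Gam, continuous (fun p : X * A => r p.1 p.2)}.
Proof. by case: H => _ _ _ []. Qed.
Lemma mdp_feller (v : X -> R) : continuous v -> (exists M, forall x, `|v x| <= M) ->
  {within graph Gam,
    continuous (fun p : X * A => \int[P p.1 p.2]_(y in [set: borel X]) v y)}.
Proof. by case: H => _ _ _ _; apply. Qed.

Lemma within_graph_open (f : X * A -> R) (U : set R) :
  {within graph Gam, continuous f} -> open U ->
  exists O : set (X * A), open O /\
    forall x a, Gam x a -> (O (x, a) <-> U (f (x, a))).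
Proof.
move=> /continuousP cf /cf /open_subspaceP[Q oQ QG]; exists Q; split=> // x a Ga.
have e : (Q `&` graph Gam) (x, a) = (f @^-1` U `&` graph Gam) (x, a) by rewrite QG.
split=> h; first by have [] : (f @^-1` U `&` graph Gam) (x, a) by rewrite -e.
by have [] : (Q `&` graph Gam) (x, a) by rewrite e.
Qed.

Lemma preimage_open_measurable (f : X -> R) :
  (forall U, open U -> measurable (f @^-1` U : set (borel X))) ->
  measurable_fun [set: borel X] (f : borel X -> R).
Proof.
move=> h; apply: (measurability _ (RGenOpens.measurableE R)).
move=> _ [_ [a [b ->] <-]]; rewrite setTI; apply: h; exact: interval_open.
Qed.

Lemma continuous_borel_measurable (f : X -> R) : continuous f ->
  measurable_fun [set: borel X] (f : borel X -> R).
Proof.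
move=> /continuousP cf; apply: preimage_open_measurable => U oU.
by apply: open_borel; exact: cf.
Qed.

Section policy.
Variable s : X -> A.
Hypothesis ps : policy Gam s.

Lemma policy_measurable (f : X * A -> R) : {within graph Gam, continuous f} ->
  measurable_fun [set: borel X] ((fun x => f (x, s x)) : borel X -> R).
Proof.
move=> cf; apply: preimage_open_measurable => U oU.
have [Q [oQ QU]] := within_graph_open cf oU.
suff -> : (fun x => f (x, s x)) @^-1` U = [set x | Q (x, s x)].
  by apply: policy_open_borel ps oQ; [exact: mdp_uhc|exact: mdp_compact].
by apply/seteqP; split=> x /=; move/QU; apply; exact: ps.2.
Qed.

(** Dynkin induction from the open sets. For these the indicator is a bounded limit of continuous
    functions, whose integrals are measurable by the Feller property and [policy_measurable]. *)
Lemma policy_kernel_measurable (U : set (borel X)) : measurable U ->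
  measurable_fun [set: borel X] ((fun x => P x (s x) U) : borel X -> \bar R).
Proof.
move=> mU; have : <<s @open X >> U by exact: mU.
apply: (@dynkin_induction _ (borel X) (@open X)
  [set U | measurable_fun [set: borel X] ((fun x => P x (s x) U) : borel X -> \bar R)]).
- by [].
- by move=> B C oB oC; exact: openI.
- rewrite /=; under eq_fun do rewrite probability_setT.
  exact: measurable_cst.
- move=> G oG /=; have [v [cv v01 vG]] := open_indic_approx oG.
  have bv n : bmeas (v n).
    split; first exact: continuous_borel_measurable.
    by exists 1 => x; have /andP[v0 v1] := v01 n x; rewrite ger0_norm.
  pose h n x := (\int[P x (s x)]_(y in [set: borel X]) (v n y)%:E)%E.
  apply: (@emeasurable_fun_cvg _ (borel X) R setT h).
    move=> n; have -> : h n =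
        EFin \o (fun x => \int[P x (s x)]_(y in [set: borel X]) v n y).
      apply/funext => x; rewrite /h /= fineK //.
      exact: (integrable_fin_num _ (bmeas_integrable _ (bv n))).
    apply/measurable_EFinP; apply: (policy_measurable (mdp_feller (cv n) _)).
    by have [_] := bv n.
  move=> x _; have mG := open_borel oG.
  have -> : P x (s x) G = (\int[P x (s x)]_(y in [set: borel X]) (\1_G y)%:E)%E.
    by rewrite integral_indic // setIT.
  apply: (@dominated_cvg _ _ _ _ _ _ _ _ (cst 1%E)) => //.
  - by move=> n; apply/measurable_EFinP; exact: (bv n).1.
  - by move=> y _; apply: cvg_EFin; [near=> n|exact: vG].
  - exact: (@bmeas_integrable R _ (borel X) (P x (s x)) _ (bmeas_cst 1)).
  - move=> n y _; have /andP[v0 v1] := v01 n y.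
    by rewrite /= lee_fin ger0_norm.
- move=> B mB mPB /=; have -> : (fun x => P x (s x) (~` B)) = (fun x => 1 - P x (s x) B)%E.
    by apply/funext => x; rewrite probability_setC.
  by apply: emeasurable_funB => //; exact: measurable_cst.
- move=> F mF tF mPF /=.
  have -> : (fun x => P x (s x) (\bigcup_k F k)) =
      (fun x => \sum_(k <oo) P x (s x) (F k))%E.
    apply/funext => x; rewrite measure_semi_bigcup //.
    exact: bigcupT_measurable.
  apply: (@ge0_emeasurable_sum _ (borel X) R setT
    (fun k x => P x (s x) (F k)) xpredT) => k //.
  by move=> _; exact: mPF.
Unshelve. all: by end_near.
Qed.

Lemma Pop_bmeas (f : X -> R) : bmeas f -> bmeas (Pop P s f).
Proof.
move=> bf; have [mf [M fM]] := bf; split; last first.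
  by exists M => x; exact: bmeas_normr_Rintegral.
(* Shifting by the bound makes the integrand nonnegative, as the measurability of kernel integrals
   requires. *)
pose g x := f x + M.
have bg : bmeas g by exact: bmeasD bf (bmeas_cst M).
have -> : Pop P s f = fun x => fine (\int[P x (s x)]_(y in [set: borel X]) (g y)%:E)%E - M.
  apply/funext => x; have := bmeas_RintegralD (P x (s x)) bf (bmeas_cst M).
  by rewrite prob_Rintegral_cst /Rintegral => ->; rewrite addrK.
apply: measurable_funB; last exact: measurable_cst.
apply: measurableT_comp => //.
apply: (@measurable_fun_integral_kernel _ _ (borel X) (borel X) R (fun x => P x (s x))).
- exact: policy_kernel_measurable.
- by move=> z; rewrite lee_fin /g; have := fM z; rewrite ler_norml => /andP[]; lra.
- by apply/measurable_EFinP; exact: bg.1.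
Qed.

Let rs y := r y (s y).

Lemma reward_bound : exists M, forall s, policy Gam s -> forall x, `|r x (s x)| <= M.
Proof. by case: H => _ _ _ [[M rM] _] _; exists M => s' ps' x; apply/rM/ps'.2. Qed.

Lemma reward_bmeas : bmeas rs.
Proof.
split; first exact: (policy_measurable mdp_reward_continuous).
by have [M h] := reward_bound; exists M; exact: h.
Qed.

Let f t := iter t (Pop P s) rs.

Lemma iter_reward_bmeas t : bmeas (f t).
Proof. by elim: t => [|t IH]; [exact: reward_bmeas|exact: Pop_bmeas]. Qed.

Lemma iter_reward_bound M : (forall x, `|rs x| <= M) -> forall t x, `|f t x| <= M.
Proof.
move=> rM; elim=> [|t IH] x; first exact: rM.
by rewrite /f iterS; apply: bmeas_normr_Rintegral => //; exact: iter_reward_bmeas.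
Qed.

Let S n x := \sum_(t < n) beta ^+ t * f t x.

Lemma partial_value_bmeas n : bmeas (S n).
Proof.
elim: n => [|n IH].
  by rewrite /S; under eq_fun do rewrite big_ord0; exact: bmeas_cst.
rewrite /S; under eq_fun do rewrite big_ord_recr /=.
by apply: bmeasD => //; apply: bmeasZ; exact: iter_reward_bmeas.
Qed.

Lemma partial_valueS n x : S n.+1 x = rs x + beta * Pop P s (S n) x.
Proof.
elim: n => [|n IH].
  rewrite /S big_ord_recr big_ord0 /= add0r expr0 mul1r /Pop.
  under eq_Rintegral do rewrite big_ord0.
  by rewrite prob_Rintegral_cst mulr0 addr0.
rewrite /S big_ord_recr /= -/(S n.+1 x) IH.
have -> : Pop P s (S n.+1) x = Pop P s (S n) x + beta ^+ n * Pop P s (f n) x.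
  rewrite -bmeas_RintegralZ; last exact: iter_reward_bmeas.
  rewrite -bmeas_RintegralD; [|exact: partial_value_bmeas|].
    by apply: eq_Rintegral => y _; rewrite /S big_ord_recr.
  by apply: bmeasZ; exact: iter_reward_bmeas.
by rewrite /f /= exprS; ring.
Qed.

Lemma value_tail M : (forall x, `|rs x| <= M) ->
  forall n x, `|vp s x - S n x| <= M / (1 - beta) * beta ^+ n.
Proof.
move=> rM n x.
exact: (discounted_tail mdp_beta (fun t => iter_reward_bound rM t x)).
Qed.

Lemma value_bound M : (forall x, `|rs x| <= M) ->
  forall x, `|vp s x| <= M / (1 - beta).
Proof.
by move=> /value_tail/(_ 0%N) h x; have := h x; rewrite /S big_ord0 subr0 mulr1.
Qed.

Lemma value_bmeas : bmeas (vp s).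
Proof.
have [M rM] := reward_bound; split; last first.
  by exists (M / (1 - beta)); apply: value_bound; exact: rM.
apply: (@measurable_fun_cvg _ (borel X) R setT S) => [n|x _].
  exact: (partial_value_bmeas n).1.
exact: (discounted_cvg mdp_beta (fun t => iter_reward_bound (rM s ps) t x)).
Qed.

Lemma value_eq x : vp s x = rs x + beta * Pop P s (vp s) x.
Proof.
have [M rM] := reward_bound; have [b0 b1] := andP mdp_beta.
have tail := value_tail (rM s ps).
apply/eqP; rewrite -subr_eq0; apply/eqP.
(* Two errors, the tail at [n.+1] and [beta] times the integrated tail at [n], are each at most
   [M / (1 - beta) * beta ^+ n.+1]. *)
apply: (le_geometric_eq0 mdp_beta (C := M / (1 - beta) * beta *+ 2)) => n.
have -> : vp s x - (rs x + beta * Pop P s (vp s) x) =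
    (vp s x - S n.+1 x) - beta * (Pop P s (vp s) x - Pop P s (S n) x).
  by rewrite partial_valueS; ring.
have h2 : `|Pop P s (vp s) x - Pop P s (S n) x| <= M / (1 - beta) * beta ^+ n.
  rewrite -bmeas_RintegralB; [|exact: value_bmeas|exact: partial_value_bmeas].
  apply: bmeas_normr_Rintegral => //.
  by apply: bmeasB; [exact: value_bmeas|exact: partial_value_bmeas].
apply: le_trans (ler_normB _ _) _; rewrite normrM (gtr0_norm b0).
have := tail n.+1 x; have := ler_wpM2l (ltW b0) h2; rewrite exprS.
set a := `| _ |; set b := _ * `| _ |; set c := M / _; set bn := _ ^+ n => h3 h4.
rewrite mulr2n mulrDl; apply: lerD; first by rewrite -mulrA.
by rewrite (mulrC c) -mulrA.
Qed.

(** Iterating the inequality improves the lower bound [- M] to [- (M * beta ^+ n)] for every [n], as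
    integration against a probability is monotone and fixes constants. *)
Lemma supersolution_ge0 (dd : X -> R) : bmeas dd ->
  (forall x, beta * Pop P s dd x <= dd x) -> forall x, 0 <= dd x.
Proof.
move=> bd h; have [b0 b1] := andP mdp_beta; have [_ [M dM]] := bd.
have lb n x : - (M * beta ^+ n) <= dd x.
  elim: n x => [|n IH] x.
    by rewrite expr0 mulr1; have := dM x; rewrite ler_norml => /andP[].
  apply: le_trans (h x).
  rewrite exprS mulrCA -mulrN ler_pM2l // -(prob_Rintegral_cst (P x (s x)) (- (M * beta ^+ n))).
  by apply: bmeas_Rintegral_le => //; exact: bmeas_cst.
move=> x; rewrite leNgt; apply/negP => d0.
suff e : dd x = 0 by rewrite e ltxx in d0.
apply: (le_geometric_eq0 mdp_beta (C := M)) => n.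
by rewrite ltr0_norm // lerNl.
Qed.

End policy.

(** * Continuity of the value of a continuous policy *)

Section continuous_policy.
Variable s : X -> A.
Hypothesis ps : policy Gam s.
Hypothesis cs : continuous s.

Lemma continuous_policy_comp (f : X * A -> R) : {within graph Gam, continuous f} ->
  continuous (fun x => f (x, s x)).
Proof.
move=> cf; apply/continuousP => U oU; have [Q [oQ QU]] := within_graph_open cf oU.
have -> : (fun x => f (x, s x)) @^-1` U = (fun x => (x, s x)) @^-1` Q.
  by apply/seteqP; split=> x /=; move/QU; apply; exact: ps.2.
apply: open_comp => // x _; apply: cvg_pair; [exact: cvg_id|exact: cs].
Qed.

(** The partial sums are continuous by the Feller property and continuity of [s], and [value_tail]
    makes their convergence uniform. *)
Lemma value_continuous : continuous (vp s).
Proof.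
have [M rM] := reward_bound; have [b0 b1] := andP mdp_beta.
have cf t : continuous (iter t (Pop P s) (fun y => r y (s y))).
  elim: t => [|t IH]; first exact: (continuous_policy_comp mdp_reward_continuous).
  apply: (continuous_policy_comp (mdp_feller IH _)).
  by have [_] := iter_reward_bmeas ps t.
have cS n : continuous (fun x => \sum_(t < n) beta ^+ t * iter t (Pop P s) (fun y => r y (s y)) x).
  elim: n => [|n IH] x.
    by under eq_fun do rewrite big_ord0; exact: cvg_cst.
  under eq_fun do rewrite big_ord_recr /=.
  apply: cvgD; first exact: IH.
  by apply: cvgM; [exact: cvg_cst|exact: cf].
move=> x; apply/cvgrPdist_lt => e e0.
have [n ne] : exists n, M / (1 - beta) * beta ^+ n < e / 3.
  have c : (M / (1 - beta) * beta ^+ n) @[n --> \oo] --> 0.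
    by apply: cvg_geometric; rewrite gtr0_norm.
  have e3 : 0 < e / 3 by lra.
  have [n _ h] := (cvgrPdist_lt _ _).1 c _ e3; exists n.
  by have := h n (leqnn n); rewrite /= sub0r normrN; apply: le_lt_trans; exact: ler_norm.
have e3 : 0 < e / 3 by lra.
apply: filterS ((cvgrPdist_lt _ _).1 (cS n x) _ e3) => y.
have := value_tail ps (rM s ps) n x; have := value_tail ps (rM s ps) n y.
set a := vp s x; set b := vp s y; set a' := bigop _ _ _; set b' := bigop _ _ _.
rewrite !ltr_norml !ler_norml; lra.
Qed.

End continuous_policy.

End mdp.

(** * Policy improvement *)

Section improvement.
Context {R : realType} (X A : pointedMetricType R).
Variables (r : X -> A -> R) (Gam : X -> set A) (beta : R).
Variable P : X -> A -> probability (borel X) R.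
Hypothesis H : MDP r Gam beta P.
Variable sigma : X -> A.
Hypothesis psigma : policy Gam sigma.

Local Notation vp := (vpol r beta P).
Local Notation bmeas := (@bmeas R _ (borel X)).
Local Notation u := (vp sigma).

(** The value of playing [a] once and following [sigma] from then on. *)
Definition qvalue (x : X) (a : A) : R :=
  r x a + beta * \int[P x a]_(y in [set: borel X]) u y.

Let bu : bmeas u := value_bmeas H psigma.

Lemma qvalue_policy x : qvalue x (sigma x) = u x.
Proof. by rewrite (value_eq H psigma x). Qed.

Lemma qvaluePop s x : qvalue x (s x) = r x (s x) + beta * Pop P s u x.
Proof. by []. Qed.

Lemma PopB s f g x : bmeas f -> bmeas g ->
  Pop P s (fun y => f y - g y) x = Pop P s f x - Pop P s g x.
Proof. exact: bmeas_RintegralB. Qed.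

(** The difference [u - vp s] dominates its discounted image under [P_s], so [supersolution_ge0]
    applies. *)
Lemma bellman_optimal : (forall x a, Gam x a -> qvalue x a <= u x) ->
  forall s, policy Gam s -> forall x, vp s x <= u x.
Proof.
move=> qu s ps x; rewrite -subr_ge0; move: x.
have bv := value_bmeas H ps.
apply: (supersolution_ge0 H (s := s)); first exact: bmeasB.
move=> x; rewrite PopB // (value_eq H ps x).
have := qu x (s x) (ps.2 x); rewrite qvaluePop.
by move: (Pop P s u x) (Pop P s (vp s) x) (r x (s x)) (u x) => a b c d; lra.
Qed.

Section improving.
Variable s : X -> A.
Hypothesis ps : policy Gam s.

Let gain x := vp s x - u x.

Let bgain : bmeas gain.
Proof. exact: bmeasB (value_bmeas H ps) bu. Qed.

(** The gain of [s] over [sigma] splits into the advantage of one step and the discounted expected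
    gain afterwards. *)
Lemma gain_eq x : gain x = qvalue x (s x) - u x + beta * Pop P s gain x.
Proof.
rewrite PopB //; last exact: (value_bmeas H ps).
rewrite /gain (value_eq H ps x) qvaluePop.
by move: (Pop P s u x) (Pop P s (vp s) x) (r x (s x)) (u x) => a b c d; ring.
Qed.

Hypothesis us : forall x, u x <= qvalue x (s x).

Lemma gain_ge0 x : 0 <= gain x.
Proof.
apply: (supersolution_ge0 H (s := s)) => // y.
by rewrite [leRHS]gain_eq lerDr subr_ge0.
Qed.

Lemma qvalue_gain_gt0 x : u x < qvalue x (s x) -> 0 < gain x.
Proof.
move=> ux; rewrite gain_eq; have [b0 _] := andP (mdp_beta H).
have I0 : 0 <= Pop P s gain x by apply: Rintegral_ge0 => y _; exact: gain_ge0.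
by rewrite ltr_wpDr ?subr_gt0 // mulr_ge0 // ltW.
Qed.

(* The policies [s] and [sigma] generate the same paths until [s] departs from
   [sigma], and at that moment a positive gain is made. *)
Lemma hitting_gain_gt0 (G : set X) n x : open G ->
  (forall x, s x = sigma x \/ u x < qvalue x (s x)) ->
  (forall x, G x -> u x < qvalue x (s x)) ->
  0 < Pn P sigma n x G -> 0 < gain x.
Proof.
move=> oG dich Gs; have [b0 _] := andP (mdp_beta H).
have biter m : bmeas (iter m (Pop P sigma) (\1_G : X -> R)).
  elim: m => [|m IH]; last exact: (Pop_bmeas H psigma).
  exact: (@bmeas_indic _ _ (borel X)) (open_borel oG).
have iter_ge0 m y : 0 <= iter m (Pop P sigma) (\1_G : X -> R) y.
  by elim: m y => [|m IH] y; [rewrite /= indicE|apply: Rintegral_ge0 => z _; exact: IH].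
rewrite /Pn; elim: n x => [|n IH] x.
  rewrite /= indicE; have [/set_mem Gx _|_] := boolP (x \in G); last by rewrite ltxx.
  by apply: qvalue_gain_gt0; exact: Gs.
have [sx|ux _] := dich x; last exact: qvalue_gain_gt0.
(* If the gain vanished at [x], where [s] and [sigma] agree, [gain_eq] would make its expectation at
   the next state zero; by induction the probability of being in [G] after [n] further steps would
   then also average to zero. *)
move=> h; rewrite lt0r gain_ge0 andbT; apply/eqP => g0.
move: h; rewrite iterS /Pop.
rewrite (@bmeas_Rintegral_support _ _ _ (P x (sigma x)) gain) ?ltxx //.
  exact: gain_ge0.
have := gain_eq x; rewrite g0 sx qvalue_policy subrr add0r => /esym/eqP.
rewrite mulf_eq0 gt_eqF //= => /eqP.
by rewrite /Pop sx => ->.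
Qed.

End improving.

Hypothesis csigma : continuous sigma.

Lemma qvalue_continuous :
  {within graph Gam, continuous (fun p : X * A => qvalue p.1 p.2 - u p.1)}.
Proof.
have cu := value_continuous H psigma csigma.
move=> p; apply: cvgB.
  apply: cvgD; first exact: (mdp_reward_continuous H).
  apply: cvgM; first exact: cvg_cst.
  by apply: (mdp_feller H cu); exact: bu.2.
apply: continuous_subspaceT p => p.
by apply: (@continuous_comp _ _ _ fst u); [exact: cvg_fst|exact: cu].
Qed.

(** The policy follows a selection of actions with excess at least [e] on the closed set [B] where
    such actions exist, and [sigma] elsewhere; [G] is the interior of [B]. *)
Lemma improving_policy y a : Gam y a -> u y < qvalue y a ->
  exists (s : X -> A) (G : set X), [/\ policy Gam s, open G, G y,
    forall x, s x = sigma x \/ u x < qvalue x (s x) &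
    forall x, G x -> u x < qvalue x (s x)].
Proof.
move=> Ga uq; pose e := (qvalue y a - u y) / 2.
have e0 : 0 < e by rewrite /e; lra.
have [Q1 [oQ1 Q1P]] := within_graph_open qvalue_continuous (@open_lt _ e).
have [Q2 [oQ2 Q2P]] := within_graph_open qvalue_continuous (@open_gt _ e).
have cL : closed (~` Q1) by rewrite closedC.
have [s0 [[ms0 s0G] s0L]] := corr_selection (mdp_uhc H) (mdp_compact H) (mdp_nonempty H) cL.
pose B := [set x | exists b, Gam x b /\ (~` Q1) (x, b)].
have mB : measurable (B : set (borel X)).
  by apply: closed_borel; exact: (corr_meets_closed (mdp_uhc H) (mdp_compact H)).
pose s x := if x \in B then s0 x else sigma x.
have sB x : B x -> u x < qvalue x (s x).
  move=> Bx; rewrite /s mem_set //; have [b [Gb Lb]] := Bx.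
  have nQ := s0L _ _ Gb Lb.
  have : ~ (qvalue x (s0 x) - u x < e) by move=> h; apply: nQ; apply/Q1P.
  by move/negP; rewrite -leNgt; lra.
exists s, (interior B); split.
- split; last by move=> x; rewrite /s; case: ifP => _; [exact: s0G|exact: psigma.2].
  move=> _ Y mY; have mY0 := ms0 measurableT Y mY; have mY1 := psigma.1 measurableT Y mY.
  suff -> : [set: borel X] `&` s @^-1` Y =
      (B `&` ([set: borel X] `&` s0 @^-1` Y)) `|` (~` B `&` ([set: borel X] `&` sigma @^-1` Y)).
    apply: (@measurableU _ (borel X)); first exact: (@measurableI _ (borel X)).
    by apply: (@measurableI _ (borel X)) => //; exact: (@measurableC _ (borel X)).
  rewrite !setTI; apply/seteqP; split=> x /=.
    rewrite /s; have [/set_mem Bx Yx|/negP nB Yx] := boolP (x \in B); [by left|right].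
    by split=> // Bx; apply: nB; exact: mem_set.
  rewrite /s; move=> [[Bx Yx]|[nB Yx]]; first by rewrite mem_set.
  by rewrite memNset.
- exact: open_interior.
- have : nbhs (y, a) Q2.
    by apply: open_nbhs_nbhs; split=> //; apply/Q2P => //=; rewrite /e; lra.
  move=> /nbhs_ballP[d /= d0 dQ].
  have N1 : \forall x \near y, Gam x `&` ball a d !=set0.
    apply: (mdp_lhc H); first exact: metric_open_ball.
    by exists a; split=> //; exact: ballxx.
  have N2 : nbhs y (ball y d) by exact: nbhsx_ballx.
  apply: filterS2 N1 N2 => x [b [Gb ab]] xy; exists b; split=> //.
  have /(Q2P _ _ Gb) /= h : Q2 (x, b) by exact: dQ.
  by move=> /(Q1P _ _ Gb) /=; rewrite ltNge ltW.
- move=> x; have [Bx|nB] := pselect (B x); first by right; exact: sB.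
  by left; rewrite /s memNset.
- by move=> x /interior_subset; exact: sB.
Qed.

End improvement.

Theorem theorem4p2 (R : realType) (X A : pointedMetricType R)
  (r : X -> A -> R) (Gam : X -> set A) (beta : R)
  (P : X -> A -> probability (borel X) R) (sigma : X -> A) :
  MDP r Gam beta P ->
  policy Gam sigma ->
  open_set_irreducible P sigma ->
  continuous sigma ->
  [<-> (exists x : X, forall s, policy Gam s ->
          vpol r beta P s x <= vpol r beta P sigma x);
       (exists rho : probability (borel X) R, forall s, policy Gam s ->
          \int[rho]_(y in [set: borel X]) vpol r beta P s y
          <= \int[rho]_(y in [set: borel X]) vpol r beta P sigma y);
       optimal r Gam beta P sigma].
Proof.
move=> H psigma irr csigma; tfae.
- move=> [x xP]; exists (@dirac _ (borel X) x R) => s ps.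
  have Rint_dirac s' : policy Gam s' ->
      \int[@dirac _ (borel X) x R]_(y in [set: borel X]) vpol r beta P s' y =
      vpol r beta P s' x.
    move=> ps'; rewrite /Rintegral integral_dirac //.
      by rewrite diracT mul1e.
    by apply/measurable_EFinP; exact: (value_bmeas H ps').1.
  by rewrite !Rint_dirac //; exact: xP.
- move=> [rho rhoP]; pose u := vpol r beta P sigma.
  have bu := value_bmeas H psigma.
  suff uv : forall s, policy Gam s -> forall x, vpol r beta P s x <= u x.
    move=> x; apply/eqP; rewrite eq_le; apply/andP; split.
      apply: ub_le_sup; last by exists sigma.
      by exists (u x) => _ [s ps <-]; exact: uv.
    apply: ge_sup; first by exists (u x), sigma.
    by move=> _ [s ps <-]; exact: uv.
  apply: (bellman_optimal H psigma) => y a Ga; rewrite leNgt; apply/negP => uq.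
  have [s [G [ps oG Gy dich Gs]]] := improving_policy H psigma csigma Ga uq.
  have us x : u x <= qvalue r beta P sigma x (s x).
    by have [->|/ltW//] := dich x; rewrite (qvalue_policy H psigma).
  have bv := value_bmeas H ps.
  have gain_gt0 x : 0 < vpol r beta P s x - u x.
    have [n [_ Pn0]] := irr x y G oG Gy.
    exact: (hitting_gain_gt0 H psigma ps us oG dich Gs Pn0).
  have /eqP := prob_Rintegral_cst rho 1.
  rewrite (@bmeas_Rintegral_support _ _ _ rho (fun x => vpol r beta P s x - u x)).
  + by rewrite eq_sym oner_eq0.
  + exact: bmeasB.
  + exact: bmeas_cst.
  + by move=> x; exact: ltW.
  + by move=> x; exact: ler01.
  + by move=> x _.
  + by rewrite bmeas_RintegralB // subr_le0; exact: rhoP.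
- move=> opt; exists point => s ps; rewrite opt.
  apply: ub_le_sup; last by exists s.
  have [M rM] := reward_bound H.
  exists (M / (1 - beta)) => _ [s' ps' <-].
  exact: le_trans (ler_norm _) (value_bound H ps' (rM s' ps') _).
Qed.
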